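(* For every integer $j \geq 3$, $$m_j(B, C_3) = \begin{cases} \infty & \text{if } j \in \{3,4,5\},\\ 2 & \text{if } j \in \{6,7,8\},\\ 1 & \text{otherwise.}\end{cases}$$
   Context: All graphs are simple. $K_{j\times s}$ denotes the complete multipartite graph with $j$ partite sets, each of size $s$. The Butterfly graph $B$ is the graph on 5 vertices consisting of two copies of the triangle $C_3$ sharing exactly one common vertex. For graphs $B$ and $G$ and an integer $j\ge 2$, the size multipartite Ramsey number $m_j(B,G)$ is the smallest natural number $s$ such that every colouring of the edges of $K_{j\times s}$ with two colours, red and blue, contains a red copy of $B$ or a blue copy of $G$; if no such $s$ exists, $m_j(B,G)=\infty$. *)

(* Defs.v *)
From mathcomp Require Import all_boot.
From mathcomp Require Import boolp.

Set Implicit Arguments.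
Unset Strict Implicit.
Unset Printing Implicit Defensive.

Record sgraph := SGraph {
  vertex :> finType;
  adj : rel vertex;
  adj_sym : symmetric adj;
  adj_irrefl : irreflexive adj }.

(* G contains a copy of H as a (not necessarily induced) subgraph. *)
Definition contains (G H : sgraph) : Prop :=
  exists f : H -> G,
    injective f /\ forall x y : H, adj x y -> adj (f x) (f y).

(* Graphs on {0, ..., n-1} given by a list of edges; each edge is listed once,
   in either orientation. *)
Section EdgeListGraph.
Variables (n : nat) (E : seq (nat * nat)).

Definition edge_list_adj (x y : 'I_n) : bool :=
  (x != y) && (((x : nat, y : nat) \in E) || ((y : nat, x : nat) \in E)).

Lemma edge_list_adj_sym : symmetric edge_list_adj.
Proof. by move=> x y; rewrite /edge_list_adj eq_sym orbC. Qed.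

Lemma edge_list_adj_irrefl : irreflexive edge_list_adj.
Proof. by move=> x; rewrite /edge_list_adj eqxx. Qed.

Definition edge_list_graph : sgraph :=
  SGraph edge_list_adj_sym edge_list_adj_irrefl.

End EdgeListGraph.

Definition C3 : sgraph := edge_list_graph 3 [:: (0, 1); (1, 2); (2, 0)].

(* The triangles 0,1,2 and 0,3,4 share exactly the vertex 0. *)
Definition butterfly : sgraph :=
  edge_list_graph 5 [:: (0, 1); (1, 2); (2, 0); (0, 3); (3, 4); (4, 0)].

(* K_{j x s}: the vertex (i, a) is the a-th vertex of the i-th partite set. *)
Section CompleteMultipartite.
Variables j s : nat.

Definition multipartite_adj (x y : 'I_j * 'I_s) : bool := x.1 != y.1.

Lemma multipartite_adj_sym : symmetric multipartite_adj.
Proof. by move=> x y; rewrite /multipartite_adj eq_sym. Qed.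

Lemma multipartite_adj_irrefl : irreflexive multipartite_adj.
Proof. by move=> x; rewrite /multipartite_adj eqxx. Qed.

Definition complete_multipartite : sgraph :=
  SGraph multipartite_adj_sym multipartite_adj_irrefl.

End CompleteMultipartite.

Definition colour : Type := bool.
Definition red : colour := true.
Definition blue : colour := false.

(* A colouring assigns a colour to the unordered pair {x, y} for each edge xy;
   its values on sets that are not edges are irrelevant. *)
Definition colouring (G : sgraph) : Type := {set G} -> colour.

Section ColourClass.
Variables (G : sgraph) (c : colouring G) (k : colour).

Definition colour_adj (x y : G) : bool := adj x y && (c [set x; y] == k :> bool).

Lemma colour_adj_sym : symmetric colour_adj.
Proof. by move=> x y; rewrite /colour_adj adj_sym setUC. Qed.

Lemma colour_adj_irrefl : irreflexive colour_adj.
Proof. by move=> x; rewrite /colour_adj adj_irrefl. Qed.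

Definition colour_class : sgraph := SGraph colour_adj_sym colour_adj_irrefl.

End ColourClass.

Definition arrows (K H G : sgraph) : Prop :=
  forall c : colouring K,
    contains (colour_class c red) H \/ contains (colour_class c blue) G.

(* m_j(H, G), with None standing for infinity.  The value s = 0 need not be
   excluded: K_{j x 0} has no vertices, so it arrows no pair of nonempty
   graphs. *)
Definition size_multipartite_ramsey (j : nat) (H G : sgraph) : option nat :=
  match pselect (exists s, `[< arrows (complete_multipartite j s) H G >]) with
  | left ex_s => Some (ex_minn ex_s)
  | right _ => None
  end.

(* Main.v *)
Require Import Defs.
From mathcomp Require Import all_boot.
From mathcomp Require Import boolp.

Set Implicit Arguments.
Unset Strict Implicit.
Unset Printing Implicit Defensive.

(** The lower bounds colour an edge according to the parts of its ends: for
    j <= 5 the blow-up of the decomposition of K_5 into two pentagons has no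
    monochromatic triangle, and for j <= 8 and s = 1 one takes red 2K_4 and
    blue K_{4,4}.

    For the upper bounds, suppose that there is neither a red butterfly nor a
    blue triangle.  The blue neighbourhood of a vertex spans only red edges, and
    for s <= 2 any five vertices of K_{j x s} span a butterfly, so blue degrees
    are at most 4.  The red neighbourhood of a vertex contains no two disjoint
    red edges, hence no two disjoint triangles of K_{j x s}; for s = 2 this
    bounds red degrees by 5, so that 2(j - 1) <= 9.  For s = 1 red degrees are
    at most 4, since a red edge among five vertices misses a triangle.  If
    j >= 9, the blue neighbourhoods Q of a vertex and Q' of an element of Q are
    then disjoint red K_4's, and a ninth vertex sends at most one red edge to
    each of them, so its blue degree is at least 6. *)

(** * Colour classes and copies of the two graphs *)

Section ColourAdj.

Variables (G : sgraph) (c : colouring G).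

Lemma colour_adjE (x y : G) :
  adj x y = colour_adj c red x y || colour_adj c blue x y.
Proof. by rewrite /colour_adj; case: (adj x y) (c _) => [] []. Qed.

Lemma colour_adj_excl (x y : G) :
  ~~ (colour_adj c red x y && colour_adj c blue x y).
Proof. by rewrite /colour_adj; case: (adj x y) (c _) => [] []. Qed.

Lemma colour_adj_adj k (x y : G) : colour_adj c k x y -> adj x y.
Proof. by case/andP. Qed.

Lemma adj_neq (x y : G) : adj x y -> x != y.
Proof. by apply: contraTneq => ->; rewrite adj_irrefl. Qed.

End ColourAdj.

Lemma uniq_nths (T : eqType) (d : T) (t : seq T) (l : seq nat) :
  uniq t -> uniq l -> all (ltn^~ (size t)) l -> uniq [seq nth d t i | i <- l].
Proof.
move=> uniq_t uniq_l /allP l_lt; rewrite map_inj_in_uniq //.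
by move=> i k /l_lt it /l_lt kt /eqP; rewrite nth_uniq // => /eqP.
Qed.

Lemma contains_butterfly (G : sgraph) (v x y z t : G) :
  uniq [:: v; x; y; z; t] ->
  adj v x -> adj v y -> adj x y -> adj v z -> adj v t -> adj z t ->
  contains G butterfly.
Proof.
move=> uniq_s vx vy xy vz vt zt.
exists (fun i : 'I_5 => nth v [:: v; x; y; z; t] i); split.
  move=> i k /eqP; rewrite nth_uniq //; exact: (fun e => val_inj (eqP e)).
by case=> [[|[|[|[|[|//]]]]] ?] [[|[|[|[|[|//]]]]] ?] //= _;
  rewrite // adj_sym.
Qed.

Lemma contains_C3 (G : sgraph) (x y z : G) :
  adj x y -> adj y z -> adj x z -> contains G C3.
Proof.
move=> xy yz xz.
have uniq_s : uniq [:: x; y; z].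
  by rewrite /= !inE negb_or (adj_neq xy) (adj_neq yz) (adj_neq xz).
exists (fun i : 'I_3 => nth x [:: x; y; z] i); split.
  move=> i k /eqP; rewrite nth_uniq //; exact: (fun e => val_inj (eqP e)).
by case=> [[|[|[|//]]] ?] [[|[|[|//]]] ?] //= _; rewrite // adj_sym.
Qed.

Lemma C3_contained (G : sgraph) :
  contains G C3 -> exists x y z : G, [/\ adj x y, adj y z & adj x z].
Proof.
case=> f [_ fP].
exists (f (inord 0)), (f (inord 1)), (f (inord 2)).
by split; apply: fP; rewrite /adj /= /edge_list_adj -val_eqE /= !inordK.
Qed.

Lemma butterfly_C3 (G : sgraph) : contains G butterfly -> contains G C3.
Proof.
case=> f [_ fP].
apply: (@contains_C3 _ (f (inord 0)) (f (inord 1)) (f (inord 2)));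
  by apply: fP; rewrite /adj /= /edge_list_adj -val_eqE /= !inordK.
Qed.

Lemma butterfly_center (G : sgraph) (f : butterfly -> G) :
  (forall x y, adj x y -> adj (f x) (f y)) ->
  forall i, i != ord0 -> adj (f ord0) (f i).
Proof.
move=> fP i i0; apply: fP.
by case: i i0 => [[|[|[|[|[|//]]]]] ?].
Qed.

(** * Colourings for the lower bounds *)

Lemma colouring_of_rel (G : sgraph) (e : rel G) : symmetric e ->
  exists c : colouring G, forall x y, adj x y -> c [set x; y] = e x y.
Proof.
move=> e_sym.
(* A set is coloured by [e] at an adjacent pair inside it; in [{x, y}] the only such pairs are
   [(x, y)] and [(y, x)], where [e] agrees by symmetry. *)
exists (fun A : {set G} =>
  [exists x in A, exists y in A, adj x y && e x y]) => x y xy.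
apply/exists_inP/idP => [[u]|exy].
  rewrite !inE => /orP[]/eqP-> /exists_inP[w];
    rewrite !inE => /orP[]/eqP->; rewrite ?adj_irrefl //= => /andP[] //.
  by rewrite e_sym.
exists x; rewrite ?inE ?eqxx //; apply/exists_inP; exists y.
  by rewrite !inE eqxx orbT.
by rewrite xy.
Qed.

Lemma not_arrows_5 j s : j <= 5 ->
  ~ arrows (complete_multipartite j s) butterfly C3.
Proof.
move=> j5.
(* On the residues mod 5 the complement of this 5-cycle is again a 5-cycle, so one check of part
   indices serves both colours. *)
pose pentagon (m n : nat) := (m.+1 %% 5 == n) || (n.+1 %% 5 == m).
have [|c cP] := @colouring_of_rel (complete_multipartite j s)
  (fun x y => pentagon x.1 y.1).
  by move=> x y; rewrite /pentagon orbC.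
suff no_C3 k : ~ contains (colour_class c k) C3.
  by move=> /(_ c)[/butterfly_C3|]; apply: no_C3.
case/C3_contained=> x [y [z []]].
move=> /andP[xy +] /andP[yz +] /andP[xz +].
rewrite !cP //; move: xy yz xz; rewrite /adj /= /multipartite_adj -!val_eqE /=.
have part_lt (u : 'I_j * 'I_s) : u.1 < 5 by apply: leq_trans j5.
move: (val x.1) (val y.1) (val z.1) (part_lt x) (part_lt y) (part_lt z).
by case: (k); do 3 case=> [|[|[|[|[|?]]]]].
Qed.

Lemma not_arrows_8 j s : j <= 8 -> s <= 1 ->
  ~ arrows (complete_multipartite j s) butterfly C3.
Proof.
move=> j8 s1.
have [|c cP] := @colouring_of_rel (complete_multipartite j s)
  (fun x y => (x.1 < 4) == (y.1 < 4)).
  by move=> x y; rewrite eq_sym.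
case/(_ c) => [[f [f_inj fP]]|/C3_contained[x [y [z []]]]]; last first.
  move=> /andP[xy +] /andP[yz +] /andP[xz +]; rewrite !cP //.
  by case: (x.1 < 4) (y.1 < 4) (z.1 < 4) => [] [] [].
have same_side i : ((f i).1 < 4) = ((f ord0).1 < 4).
  have [->//|i0] := eqVneq i ord0.
  have /andP[fi] := butterfly_center fP i0.
  by rewrite cP // => /eqP/eqP->.
(* As [s <= 1], a vertex is determined by its part index, and indices on one side of 4 differ mod 4.
   So five vertices on the side of the centre would inject into four residues. *)
have mod4_inj : injective (fun i => inord ((f i).1 %% 4) : 'I_4).
  move=> i k /(congr1 val); rewrite /= !inordK ?ltn_mod // => eq_mod.
  apply: f_inj; apply/eqP; rewrite [_ == _]xpair_eqE -!val_eqE /=.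
  have lt1 u : (f u).2 < 1 by apply: leq_trans s1.
  have lt8 u : (f u).1 < 8 by apply: leq_trans j8.
  have := lt1 i; have := lt1 k; rewrite !ltnS !leqn0 => /eqP-> /eqP->.
  move: eq_mod (lt8 i) (lt8 k); have := same_side i; rewrite -(same_side k).
  move: (val (f i).1) (val (f k).1).
  by do 2 case=> [|[|[|[|[|[|[|[|?]]]]]]]].
by have := leq_card _ mod4_inj; rewrite !card_ord.
Qed.

Lemma not_arrows_0 j : ~ arrows (complete_multipartite j 0) butterfly C3.
Proof.
by case/(_ (fun=> red)) => -[f _]; case: (f ord0) => _ [].
Qed.

(** * Upper bounds: degrees in a colouring with neither graph *)

(* Listed part by part, vertices two steps apart lie in different parts, since
   otherwise some part would have three vertices. *)
Lemma vertices_by_part j s (A : {set complete_multipartite j s}) n :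
  s <= 2 -> n <= #|A| ->
  exists t, [/\ uniq t, size t = n, {subset t <= A}
    & forall d i k, i.+1 < k < n -> adj (nth d t i) (nth d t k)].
Proof.
move=> s2 /card_geqP[t [uniq_t size_t tA]].
pose le_part (x y : complete_multipartite j s) := x.1 <= y.1.
have le_part_tr : transitive le_part by move=> y x z; apply: leq_trans.
have le_part_refl : reflexive le_part by move=> x; apply: leqnn.
have le_part_total : total le_part by move=> x y; apply: leq_total.
exists (sort le_part t); split; rewrite ?sort_uniq ?size_sort //.
  by move=> x; rewrite mem_sort; apply: tA.
move=> d i k /andP[ik kn]; apply/negP => /eqP part_ik.
have sorted_t := sort_sorted le_part_total t.
have uniq_s : uniq (sort le_part t) by rewrite sort_uniq.
have size_s : size (sort le_part t) = n by rewrite size_sort.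
move: (sort le_part t) sorted_t uniq_s size_s part_ik => u su uu zu part_ik.
have le_nth a b : a <= b -> b < n -> (nth d u a).1 <= (nth d u b).1.
  move=> ab bn; apply: (sorted_leq_nth le_part_tr le_part_refl d su) => //.
    by rewrite inE zu (leq_ltn_trans ab).
  by rewrite inE zu.
have i1n : i.+1 < n by apply: ltn_trans kn.
(* Sorting squeezes the part of position [i.+1] between the equal parts of [i] and [k]; [g] then
   lists three vertices of one part. *)
have part_i1 : (nth d u i.+1).1 = (nth d u i).1.
  apply/val_inj/eqP; rewrite eqn_leq (le_nth i i.+1) // andbT.
  by rewrite [X in _ <= val X]part_ik le_nth // ltnW.
pose g (m : 'I_3) := nth d u (nth 0 [:: i; i.+1; k] m).
have g_part m : (g m).1 = (nth d u i).1.
  by case: m => [[|[|[|//]]] ?] //=; rewrite /g /= -?part_ik.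
have g_inj : injective g.
  move=> m m' /eqP; rewrite nth_uniq // ?zu.
  - by rewrite nth_uniq //=; [move/eqP/val_inj | rewrite !inE negb_or !neq_ltn;
      rewrite ltnSn ik (ltn_trans _ ik) ?ltnSn].
  - by case: m => [[|[|[|//]]] ?] //=; apply: ltn_trans i1n.
  - by case: m' => [[|[|[|//]]] ?] //=; apply: ltn_trans i1n.
have g2_inj : injective (fun m => (g m).2).
  move=> m m' eq2; apply: g_inj; move: eq2 (g_part m) (g_part m').
  by case: (g m) (g m') => [? ?] [? ?] /= -> -> ->.
by have := leq_card _ g2_inj; rewrite !card_ord leqNgt ltnS s2.
Qed.

Section UpperBound.

Variables (j s : nat) (c : colouring (complete_multipartite j s)).

Hypothesis no_red_butterfly : ~ contains (colour_class c red) butterfly.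
Hypothesis no_blue_C3 : ~ contains (colour_class c blue) C3.

Local Notation K := (complete_multipartite j s).
Local Notation r := (colour_adj c red).
Local Notation b := (colour_adj c blue).
Local Notation N k v := [set x : K | colour_adj c k v x].

Lemma adj_neqE (x y : K) : s <= 1 -> adj x y = (x != y).
Proof.
move=> s1; rewrite [x == y]xpair_eqE (_ : x.2 = y.2) ?eqxx ?andbT //.
have lt1 (u : K) : u.2 < 1 by apply: leq_trans s1.
apply: val_inj; move: (lt1 x) (lt1 y).
by rewrite /= !ltnS !leqn0 => /eqP-> /eqP->.
Qed.

Lemma no_red_butterflyP (v x y z t : K) : uniq [:: v; x; y; z; t] ->
  r v x -> r v y -> r x y -> r v z -> r v t -> r z t -> False.
Proof.
move=> u vx vy xy vz vt zt; apply: no_red_butterfly.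
exact: (@contains_butterfly (colour_class c red) v x y z t).
Qed.

Lemma red_of_blue_nbrs (v x y : K) : b v x -> b v y -> adj x y -> r x y.
Proof.
rewrite (colour_adjE c) => vx vy /orP[//|xy]; case: no_blue_C3.
exact: (@contains_C3 (colour_class c blue) v x y).
Qed.

Lemma red_edge_of_triangle (x y z : K) : adj x y -> adj y z -> adj x z ->
  [\/ r x y, r y z | r x z].
Proof.
rewrite !(colour_adjE c) => /orP[xy|xy]; first by constructor 1.
case/orP=> [yz|yz]; first by constructor 2.
case/orP=> [xz|xz]; first by constructor 3.
by case: no_blue_C3; exact: (@contains_C3 (colour_class c blue) x y z).
Qed.

(** Joined to [v], the two edges would form a red butterfly centred at [v]. *)
Lemma disjoint_red_edges (v d : K) (t : seq K) (i k l m : nat) :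
  uniq t -> {subset t <= N red v} ->
  uniq [:: i; k; l; m] -> all (ltn^~ (size t)) [:: i; k; l; m] ->
  r (nth d t i) (nth d t k) -> r (nth d t l) (nth d t m) -> False.
Proof.
move=> uniq_t tv uniq_l l_lt ik lm.
have vr a : a \in [:: i; k; l; m] -> r v (nth d t a).
  by move=> al; have := tv _ (mem_nth d (allP l_lt a al)); rewrite inE.
apply: no_red_butterflyP (vr i _) (vr k _) ik (vr l _) (vr m _) lm;
  rewrite ?inE ?eqxx ?orbT //.
rewrite cons_uniq (uniq_nths d uniq_t uniq_l l_lt) andbT.
apply/(@mapP _ _ (nth d t) [:: i; k; l; m]) => -[a /vr + va]; rewrite -va.
by rewrite colour_adj_irrefl.
Qed.

Lemma blue_degree (v : K) : s <= 2 -> #|N blue v| <= 4.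
Proof.
move=> s2; rewrite leqNgt; apply/negP => /(vertices_by_part s2).
case=> t [uniq_t size_t tv /(_ v)].
pose x i := nth v t i; rewrite -/(x) => far_adj.
have red_x i k : i < 5 -> k < 5 -> adj (x i) (x k) -> r (x i) (x k).
  have in_N a : a < 5 -> b v (x a).
    by rewrite -size_t => /(mem_nth v)/tv; rewrite inE.
  by move=> /in_N vi /in_N; apply: red_of_blue_nbrs.
have far_red i k : i.+1 < k < 5 -> r (x i) (x k).
  move=> ik; apply: red_x (far_adj i k ik); case/andP: ik => // ik.
  by move/(ltn_trans ik)/ltnW.
have butterfly_x (i k l m n : nat) :
    uniq [:: i; k; l; m; n] -> all (ltn^~ 5) [:: i; k; l; m; n] ->
    r (x i) (x k) -> r (x i) (x l) -> r (x k) (x l) ->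
    r (x i) (x m) -> r (x i) (x n) -> r (x m) (x n) -> False.
  rewrite -size_t => uniq_l l_lt; apply: no_red_butterflyP.
  exact: (uniq_nths v uniq_t uniq_l l_lt).
have sym i k : r (x i) (x k) = r (x k) (x i) by rewrite colour_adj_sym.
have part_trans (y z w : K) : ~~ adj y z -> adj y w -> adj z w.
  by rewrite negbK => /eqP yz; rewrite /adj /= /multipartite_adj yz.
(* Only consecutive positions can share a part. The centre is 0 if 0 and 1 are adjacent, else 2 if 2
   and 3 are, else 4; two non-adjacent vertices have the same neighbours, which supplies the
   remaining consecutive edge. *)
have [/(red_x 0 1 isT isT) r01|n01] := boolP (adj (x 0) (x 1)).
  by apply: (butterfly_x 0 1 3 2 4) => //; apply: far_red.
have r12 := red_x 1 2 isT isT (part_trans _ _ _ n01 (far_adj 0 2 isT)).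
have [/(red_x 2 3 isT isT) r23|n23] := boolP (adj (x 2) (x 3)).
  by apply: (butterfly_x 2 0 3 1 4) => //; try exact: far_red;
    rewrite sym // far_red.
have r34 := red_x 3 4 isT isT (part_trans _ _ _ n23 (far_adj 2 4 isT)).
by apply: (butterfly_x 4 0 2 1 3) => //; try exact: far_red;
    rewrite sym // far_red.
Qed.

Lemma red_degree_2 (v : K) : s <= 2 -> #|N red v| <= 5.
Proof.
move=> s2; rewrite leqNgt; apply/negP => /(vertices_by_part s2).
case=> t [uniq_t size_t tv /(_ v) far_adj].
have disj i k l m := @disjoint_red_edges v v t i k l m uniq_t tv.
rewrite size_t in disj.
(* The even and the odd positions span disjoint triangles, each with a red edge. *)
have := red_edge_of_triangle (far_adj 0 2 isT) (far_adj 2 4 isT)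
  (far_adj 0 4 isT).
have := red_edge_of_triangle (far_adj 1 3 isT) (far_adj 3 5 isT)
  (far_adj 1 5 isT).
by case=> e [] e'; apply: disj e e'.
Qed.

Lemma red_degree_1 (v : K) : s <= 1 -> #|N red v| <= 4.
Proof.
move=> s1; rewrite leqNgt; apply/negP => /card_geqP[t [uniq_t size_t tv]].
have disj i k l m := @disjoint_red_edges v v t i k l m uniq_t tv.
rewrite size_t in disj.
have adj_t i k : i != k -> i < 5 -> k < 5 -> adj (nth v t i) (nth v t k).
  by move=> ik i5 k5; rewrite adj_neqE // nth_uniq ?size_t.
have tri i k l : uniq [:: i; k; l] -> all (ltn^~ 5) [:: i; k; l] ->
    [\/ r (nth v t i) (nth v t k), r (nth v t k) (nth v t l)
      | r (nth v t i) (nth v t l)].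
  rewrite /= !inE negb_or !andbT => /andP[/andP[ik il] kl] /and3P[i5 k5 l5].
  by apply: red_edge_of_triangle; apply: adj_t.
(* Each case takes the triangle on the three positions off the red edge found. *)
case: (tri 0 1 2 isT isT) => e.
- by case: (tri 2 3 4 isT isT) => e'; apply: disj e e'.
- by case: (tri 0 3 4 isT isT) => e'; apply: disj e e'.
- by case: (tri 1 3 4 isT isT) => e'; apply: disj e e'.
Qed.

(** If [w] had red neighbours [x] and [y] in [Q], the triangle [x w y] and the triangle of [x] with
    the other two elements of [Q] would form a red butterfly. *)
Lemma red_K4_red_nbrs (w : K) (Q : {set K}) : #|Q| = 4 ->
  {in Q &, forall x y, x != y -> r x y} -> w \notin Q ->
  #|Q :&: N red w| <= 1.
Proof.
move=> cardQ redQ wQ; rewrite leqNgt; apply/negP => /card_gt1P[x [y []]].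
rewrite !inE => /andP[xQ wx] /andP[yQ wy] xy.
have : 1 < #|Q :\ x :\ y|.
  have := cardsD1 x Q; rewrite (cardsD1 y (Q :\ x)) cardQ xQ !inE yQ.
  by rewrite [y == x]eq_sym xy !add1n => -[<-].
case/card_gt1P=> [z [t []]]; rewrite !inE.
move=> /and3P[zy zx zQ] /and3P[ty tx tQ] zt.
have wnQ q : q \in Q -> w != q by apply: contraTneq => <-.
have xz : x != z by rewrite eq_sym.
have xt : x != t by rewrite eq_sym.
have yz : y != z by rewrite eq_sym.
have yt : y != t by rewrite eq_sym.
apply: (@no_red_butterflyP x w y z t) => //; try exact: redQ.
  by rewrite /= !inE !negb_or xy xz xt yz yt zt [x == w]eq_sym !wnQ.
by rewrite colour_adj_sym.
Qed.

Lemma red_K4_blue_nbrs (w : K) (Q : {set K}) : s <= 1 -> #|Q| = 4 ->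
  {in Q &, forall x y, x != y -> r x y} -> w \notin Q ->
  2 < #|Q :&: N blue w|.
Proof.
move=> s1 cardQ redQ wQ; have := red_K4_red_nbrs cardQ redQ wQ.
have: Q = (Q :&: N red w) :|: (Q :&: N blue w).
  rewrite -setIUr; apply/esym/setIidPl/subsetP => x xQ; rewrite !inE.
  by rewrite -colour_adjE adj_neqE //; apply: contraNneq wQ => ->.
move/(congr1 (fun A : {set K} => #|A|)); rewrite cardQ => cardQ'.
have [+ _] := leq_card_setU (Q :&: N red w) (Q :&: N blue w).
rewrite -cardQ' => le4 le1.
rewrite -(ltn_add2l 1); exact: leq_trans le4 (leq_add le1 (leqnn _)).
Qed.

Lemma degree_sum (v : K) : #|N red v| + #|N blue v| = j.-1 * s.
Proof.
rewrite -cardsUI [_ :&: _](_ : _ = set0) ?cards0 ?addn0; last first.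
  by apply/setP => x; rewrite !inE; apply/negbTE/colour_adj_excl.
(* The neighbours of [v] are exactly the vertices outside its part. *)
rewrite (_ : _ :|: _ = setX [set~ v.1] setT).
  by rewrite cardsX cardsC1 cardsT !card_ord.
by apply/setP => x; rewrite !inE andbT -colour_adjE eq_sym.
Qed.

Lemma no_K6x2 : s = 2 -> j <= 5.
Proof.
case: (posnP j) => [->//|j0] s2; have s0 : 0 < s by rewrite s2.
pose v : K := (Ordinal j0, Ordinal s0).
have := leq_add (@red_degree_2 v _) (@blue_degree v _); rewrite degree_sum s2.
move=> /(_ isT isT); rewrite -(prednK j0).
by case: (j.-1) => [|[|[|[|[|?]]]]].
Qed.

Lemma no_K9 : s = 1 -> j <= 8.
Proof.
move=> s1; rewrite leqNgt; apply/negP => j9.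
have le_s1 : s <= 1 by rewrite s1.
have le_s2 : s <= 2 by apply: ltnW.
have j0 : 0 < j by apply: leq_trans j9.
have s0 : 0 < s by rewrite s1.
(* At least 4, because the total degree [j.-1] is at least 8 and the red degree at most 4. *)
have card_blue v : #|N blue v| = 4.
  apply/eqP; rewrite eqn_leq blue_degree //=.
  have sum_v : #|N red v| + #|N blue v| = j.-1.
    by rewrite degree_sum s1 muln1.
  rewrite -(leq_add2l 4) -[4 + 4]/8.
  apply: leq_trans (leq_add (red_degree_1 v le_s1) (leqnn _)).
  by rewrite sum_v -ltnS prednK.
have redN v : {in N blue v &, forall x y, x != y -> r x y}.
  move=> x y; rewrite !inE => vx vy xy; apply: red_of_blue_nbrs vx vy _.
  by rewrite adj_neqE.
pose v : K := (Ordinal j0, Ordinal s0).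
have [a] : exists a, a \in N blue v by apply/card_gt0P; rewrite card_blue.
rewrite inE => va.
(* A common element would close a blue triangle with [v] and [a]. *)
have disj : N blue v :&: N blue a = set0.
  apply/setP => x; rewrite !inE; apply/negbTE/negP => /andP[vx ax].
  have := colour_adj_excl c a x; rewrite ax andbT => /negP[].
  by apply: (redN v); rewrite ?inE // (adj_neq (colour_adj_adj ax)).
have [w] : exists w, w \in ~: (N blue v :|: N blue a).
  apply/card_gt0P; rewrite cardsCs setCK subn_gt0 cardsU disj cards0 subn0.
  by rewrite !card_blue card_prod !card_ord s1 muln1.
rewrite in_setC in_setU negb_or => /andP[wv wa].
have nbrs_v := red_K4_blue_nbrs le_s1 (card_blue v) (@redN v) wv.
have nbrs_a := red_K4_blue_nbrs le_s1 (card_blue a) (@redN a) wa.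
(* This contradicts the three blue neighbours of [w] in each of the two disjoint sets. *)
have : #|(N blue v :|: N blue a) :&: N blue w| <= 4.
  by rewrite -(card_blue w) subset_leq_card // subsetIr.
rewrite setIUl cardsU setIACA disj set0I cards0 subn0.
by rewrite leqNgt (leq_trans _ (leq_add nbrs_v nbrs_a)).
Qed.

End UpperBound.

(** * Values of the Ramsey number *)

Lemma arrows_9 j : 9 <= j -> arrows (complete_multipartite j 1) butterfly C3.
Proof.
move=> j9 c; apply: contrapT => /not_orP[no_red no_blue].
by have := no_K9 no_red no_blue erefl; rewrite leqNgt j9.
Qed.

Lemma arrows_6x2 j : 6 <= j -> arrows (complete_multipartite j 2) butterfly C3.
Proof.
move=> j6 c; apply: contrapT => /not_orP[no_red no_blue].
by have := no_K6x2 no_red no_blue erefl; rewrite leqNgt j6.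
Qed.

Lemma size_multipartite_ramsey_eq (j s : nat) (H G : sgraph) :
  arrows (complete_multipartite j s) H G ->
  (forall s', s' < s -> ~ arrows (complete_multipartite j s') H G) ->
  size_multipartite_ramsey j H G = Some s.
Proof.
move=> arr min_s; rewrite /size_multipartite_ramsey.
case: pselect => [ex_s|[]]; last by exists s; apply/asboolP.
case: ex_minnP => m /asboolP arr_m le_m; congr Some.
apply/eqP; rewrite eqn_leq le_m /=; last exact/asboolP.
by rewrite leqNgt; apply/negP => lt_ms; case: (min_s m lt_ms).
Qed.

Theorem theorem3p3 (j : nat) (hj : 3 <= j) :
  size_multipartite_ramsey j butterfly C3 =
    if j \in [:: 3; 4; 5] then None
    else if j \in [:: 6; 7; 8] then Some 2
    else Some 1.
Proof.
have [j5|j6] := leqP j 5.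
  rewrite (_ : j \in _); last by move: j hj j5; do 6 case=> [//|].
  rewrite /size_multipartite_ramsey; case: pselect => // ex_s.
  by exfalso; case: ex_s => s /asboolP; apply: not_arrows_5.
rewrite (_ : j \in _ = false); last by move: j j6 {hj}; do 6 case=> [//|].
have [j8|j9] := leqP j 8.
  rewrite (_ : j \in _); last by move: j j6 j8 {hj}; do 9 case=> [//|].
  apply: size_multipartite_ramsey_eq; first exact: arrows_6x2.
  by move=> s s2; apply: not_arrows_8.
rewrite (_ : j \in _ = false); last by move: j j9 {hj j6}; do 9 case=> [//|].
apply: size_multipartite_ramsey_eq; first exact: arrows_9.
by case=> // _; apply: not_arrows_0.
Qed.
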